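(* Let $\mathbb{P}$ be a set of probability distributions on $(\mathcal{Z},\mathcal{B})$, all absolutely continuous with respect to one common $\sigma$-finite measure, and let $\mathbb{P}_0,\mathbb{P}_1$ be a partition of $\mathbb{P}$ into nonempty sets. The following statements are equivalent: (a) for every $Q\in\mathbb{P}_1$ there exists a sequence $\{P_k\}_{k}\subseteq co(\mathbb{P}_0)$ such that $d_{TV}(P_k,Q)\to 0$; (b) for every test $\phi$ and every $Q\in\mathbb{P}_1$, $\ \mathbb{E}_Q[\phi]\le \sup_{P\in\mathbb{P}_0}\mathbb{E}_P[\phi]$.
   Context: $\mathcal{Z}$ is a subset of the Euclidean space $\mathbb{R}^{n\times l}$ with Borel $\sigma$-algebra $\mathcal{B}$. A test is a measurable function $\phi:\mathcal{Z}\to[0,1]$; $\mathbb{E}_P[\phi]=\int\phi\,dP$. For a set $\mathbb{P}'$ of distributions, $co(\mathbb{P}')$ is its convex hull, i.e. the set of all finite mixtures $\sum_{i=1}^N\alpha_iP_i$ with $N\in\mathbb{N}$, $P_i\in\mathbb{P}'$, $\alpha_i\in[0,1]$, $\sum_i\alpha_i=1$. The total variation metric is $d_{TV}(P,Q)=\sup_{B\in\mathcal{B}}|P(B)-Q(B)|$. *)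

(* Defs.v *)
From HB Require Import structures.
From mathcomp Require Import all_boot all_order all_algebra.
From mathcomp Require Import all_classical all_reals all_analysis.

Set Implicit Arguments.
Unset Strict Implicit.
Unset Printing Implicit Defensive.

Import Order.TTheory GRing.Theory Num.Theory.
Import numFieldNormedType.Exports.

Local Open Scope classical_set_scope.
Local Open Scope ring_scope.
Local Open Scope ereal_scope.

Section subset_borel.
Context {X : topologicalType} {Z : set X}.

(* [Z] with the subspace topology, as a type. The proof that [Z] is nonempty
   is only there because [measurableType]s must be pointed; a set carrying a
   probability measure is nonempty anyway. *)
Definition subset_space (Z_neq0 : Z !=set0) : Type := set_type Z.

Variable Z_neq0 : Z !=set0.

HB.instance Definition _ :=
  Topological.copy (subset_space Z_neq0) (set_type Z).

HB.instance Definition _ := isPointed.Build (subset_space Z_neq0)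
  (SigSub (mem_set (projT2 (cid Z_neq0)))).

Definition subset_borel :=
  g_sigma_algebraType (@open (subset_space Z_neq0)).

End subset_borel.

Section distributions.
Context {d : measure_display} {T : measurableType d} {R : realType}.
Implicit Types P Q : probability T R.

(* A [probability] is a function on all of [set T] whose values outside the
   sigma-algebra are irrelevant, so distributions are compared on measurable
   sets only, here and in [co]. *)
Definition same_distribution P Q :=
  forall B : set T, measurable B -> P B = Q B.

Definition partition_in_two (PP PP0 PP1 : set (probability T R)) :=
  [/\ PP = PP0 `|` PP1, PP0 !=set0, PP1 !=set0 &
      forall P Q, PP0 P -> PP1 Q -> ~ same_distribution P Q].

Definition co (PP : set (probability T R)) : set (probability T R) :=
  [set P | exists (N : nat) (a : 'I_N -> R) (Ps : 'I_N -> probability T R),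
    [/\ forall i, (0 <= a i <= 1)%R, (\sum_(i < N) a i = 1)%R,
        forall i, PP (Ps i) &
        forall B : set T, measurable B ->
          P B = \sum_(i < N) (a i)%:E * Ps i B]].

Definition dTV P Q : \bar R :=
  ereal_sup [set `|P B - Q B| | B in measurable].

Definition is_test (phi : T -> R) :=
  measurable_fun [set: T] phi /\ forall z, (0 <= phi z <= 1)%R.

End distributions.

(* Main.v *)
(* For dominated distributions with densities f, q with respect to a finite
   measure nu, d_TV(P, Q) is the integral of (q - f)^+, that is the largest
   value of E_Q[phi] - E_P[phi] over all tests phi, whence (a) implies (b).

   Conversely, if co(PP0) is at distance at least delta from Q, a separating test
   is found without Hahn-Banach or weak compactness. Replace h^+ by its smoothing
   Psi(h) = max_{0 <= p <= 1} (p h - e p^2 / 2), whose derivative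
   clamp(h / e, 0, 1) is a test, and let J(f) be the integral of Psi(q - f). For
   small e, m = inf J over the densities of co(PP0) is positive. The infimum need
   not be attained in L^1, but the dual strong convexity of Psi makes the
   derivatives along any minimising sequence Cauchy in L^2, so they converge to
   one test phi independent of the sequence. Perturbing a minimising sequence
   towards g by vanishing steps keeps it minimising, and first-order optimality
   yields E_Q[phi] - E_P[phi] >= m for every P in PP0, contradicting (b). *)
Require Import Defs.
From HB Require Import structures.
From mathcomp Require Import all_boot all_order all_algebra.
From mathcomp Require Import all_classical all_reals all_analysis.
From mathcomp Require Import measurable_realfun ring lra.

Set Implicit Arguments.
Unset Strict Implicit.
Unset Printing Implicit Defensive.

Import Order.TTheory GRing.Theory Num.Theory.
Import numFieldNormedType.Exports.

Local Open Scope classical_set_scope.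
Local Open Scope ring_scope.
Local Open Scope ereal_scope.

(** * Smoothing the positive part on the real line *)

Section huber.
Context {R : realType}.
Local Open Scope ring_scope.
Implicit Types e h p : R.

Definition clamp e h := Num.max 0 (Num.min 1 (h / e)).

(* The maximum of [p * h - e / 2 * p ^+ 2] over [p] in [[0, 1]], attained at
   [p = clamp e h]: a Huber-type smoothing of the positive part of [h]. *)
Definition huber e h := clamp e h * h - e / 2 * clamp e h ^+ 2.

Lemma clamp_itv e h : 0 <= clamp e h <= 1.
Proof. by rewrite /clamp le_max lexx/= ge_max ler01/= ge_min lexx. Qed.

(* [clamp e h] is the projection of [h / e] onto [[0, 1]]. *)
Lemma clamp_obtuse e h p : 0 < e -> 0 <= p <= 1 ->
  0 <= (clamp e h - p) * (h - e * clamp e h).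
Proof.
move=> e0 /andP[p0 p1].
have he : h = e * (h / e) by rewrite mulrC divfK ?gt_eqF.
rewrite /clamp {2}he; move: (h / e) => u {he}; rewrite -mulrBr.
have [u1|u1] := leP 1 u.
  by rewrite (max_idPr _) ?ler01// !mulr_ge0 ?subr_ge0// ltW.
have [u0|u0] := leP 0 u; first by rewrite subrr !mulr0.
rewrite sub0r subr0 mulrCA mulr_ge0 ?(ltW e0)// mulr_le0// ?oppr_le0// ltW//.
Qed.

(** With [c = clamp e h], the right side minus the left is [(c - p) * (h - e * c) + e / 2 * (c - p)
    ^+ 2], whose first term is handled by [clamp_obtuse]. *)
Lemma huber_dual e h p : 0 < e -> 0 <= p <= 1 ->
  p * h - e / 2 * p ^+ 2 <= huber e h.
Proof.
move=> e0 p01; have := clamp_obtuse h e0 p01.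
have := mulr_ge0 (ltW e0) (sqr_ge0 (clamp e h - p)).
rewrite /huber; set c := clamp e h; nra.
Qed.

(** The gap is exactly [(clamp e h - clamp e h0) * (h - e * clamp e h)], so [clamp_obtuse] applies.
    The square, which goes beyond convexity, is what later controls the tests in L^2. *)
Lemma huber_tangent e h h0 : 0 < e ->
  huber e h0 + clamp e h0 * (h - h0)
    + e / 2 * (clamp e h - clamp e h0) ^+ 2 <= huber e h.
Proof.
move=> e0; have := clamp_obtuse h e0 (clamp_itv e h0).
rewrite /huber; set c := clamp e h; set c0 := clamp e h0; nra.
Qed.

Lemma huber_ge0 e h : 0 < e -> 0 <= huber e h.
Proof.
by move=> e0; have := @huber_dual e h 0 e0; rewrite lexx ler01 => /(_ isT); lra.
Qed.

Lemma huber_le_norm e h : 0 < e -> huber e h <= `|h|.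
Proof.
move=> e0; have /andP[c0 c1] := clamp_itv e h.
have hh := ler_norm h; have h0 := normr_ge0 h.
have := mulr_ge0 (ltW e0) (sqr_ge0 (clamp e h)).
rewrite /huber; set c := clamp e h in c0 c1 *; nra.
Qed.

Lemma huber_le_clampM e h : 0 < e -> huber e h <= clamp e h * h.
Proof.
by move=> e0; rewrite /huber gerBl mulr_ge0 ?sqr_ge0 ?divr_ge0 ?ltW.
Qed.

(** For [h >= 0] this is the competitor [p = 1]: smoothing costs at most [e / 2]. *)
Lemma huber_ge_pos e h : 0 < e -> Num.max 0 h - e / 2 <= huber e h.
Proof.
move=> e0; have [h0|h0] := leP 0 h.
  by have := @huber_dual e h 1 e0; rewrite lexx ler01 => /(_ isT); lra.
by have := huber_ge0 h e0; lra.
Qed.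

(** Add the two tangent inequalities at the midpoint: the linear terms cancel, and [(c1 - c) ^+ 2 +
    (c2 - c) ^+ 2 >= (c1 - c2) ^+ 2 / 2] by the parallelogram identity. *)
Lemma huber_midpoint e h1 h2 : 0 < e ->
  e / 4 * (clamp e h1 - clamp e h2) ^+ 2 + 2 * huber e ((h1 + h2) / 2)
    <= huber e h1 + huber e h2.
Proof.
move=> e0; set h0 := (h1 + h2) / 2.
have := huber_tangent h1 h0 e0; have := huber_tangent h2 h0 e0.
have -> : h2 - h0 = - (h1 - h0) by rewrite /h0; field.
set c := clamp e h0; set c1 := clamp e h1; set c2 := clamp e h2.
have := mulr_ge0 (ltW e0) (sqr_ge0 (c1 + c2 - 2 * c)); nra.
Qed.

Lemma huber_convex e t h1 h2 : 0 < e -> 0 <= t <= 1 ->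
  huber e ((1 - t) * h1 + t * h2) <= (1 - t) * huber e h1 + t * huber e h2.
Proof.
move=> e0 /andP[t0 t1]; set h0 := _ + t * h2.
have E1 := huber_tangent h1 h0 e0; have E2 := huber_tangent h2 h0 e0.
have F1 := mulr_ge0 (ltW e0) (sqr_ge0 (clamp e h1 - clamp e h0)).
have F2 := mulr_ge0 (ltW e0) (sqr_ge0 (clamp e h2 - clamp e h0)).
have {E1 F1} G1 : huber e h0 + clamp e h0 * (h1 - h0) <= huber e h1 by lra.
have {E2 F2} G2 : huber e h0 + clamp e h0 * (h2 - h0) <= huber e h2 by lra.
have -> : huber e h0 = (1 - t) * (huber e h0 + clamp e h0 * (h1 - h0))
    + t * (huber e h0 + clamp e h0 * (h2 - h0)) by rewrite /h0; ring.
by apply: lerD; apply: ler_wpM2l; rewrite ?subr_ge0.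
Qed.

Lemma measurable_clamp e : measurable_fun [set: R] (clamp e).
Proof.
by apply: measurable_maxr => //; apply: measurable_minr => //; exact: measurable_funM.
Qed.

Lemma measurable_huber e : measurable_fun [set: R] (huber e).
Proof.
have mc := measurable_clamp e.
apply: measurable_funB; first exact: measurable_funM.
by apply: measurable_funM => //; exact: measurable_funX.
Qed.

End huber.

(** * Integrable functions and tests under a finite measure *)

Section real_integrals.
Context d (T : measurableType d) (R : realType).
Variable nu : {finite_measure set T -> \bar R}.
Local Open Scope ring_scope.
Implicit Types f g phi : T -> R.

Local Notation L1 f := (nu.-integrable [set: T] (EFin \o f)).

Lemma L1_measurable f : L1 f -> measurable_fun [set: T] f.
Proof. by move=> /measurable_int /measurable_EFinP. Qed.

Lemma L1_le f g : measurable_fun [set: T] f -> L1 g ->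
  (forall x, `|f x| <= `|g x|) -> L1 f.
Proof.
move=> mf ig fg; apply: le_integrable ig => //; first exact/measurable_EFinP.
by move=> x _; rewrite /= lee_fin.
Qed.

Lemma L1D f g : L1 f -> L1 g -> L1 (fun x => f x + g x).
Proof. by move=> if_ ig; exact: (integrableD measurableT if_ ig). Qed.

Lemma L1B f g : L1 f -> L1 g -> L1 (fun x => f x - g x).
Proof. by move=> if_ ig; exact: (integrableB measurableT if_ ig). Qed.

Lemma L1Z r f : L1 f -> L1 (fun x => r * f x).
Proof. by move=> if_; exact: (integrableZl measurableT r if_). Qed.

Lemma L1_cst r : L1 (fun=> r).
Proof. exact: (finite_measure_integrable_cst nu r measurableT). Qed.

Lemma L1_testM phi f : is_test phi -> L1 f -> L1 (fun x => phi x * f x).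
Proof.
move=> [mphi phi01] if_; apply: (L1_le _ if_).
  by apply: measurable_funM => //; exact: L1_measurable.
move=> x; have /andP[p0 p1] := phi01 x.
by rewrite normrM ler_piMl// ger0_norm.
Qed.

Lemma L1_pos f : L1 f -> L1 (fun x => Num.max 0 (f x)).
Proof.
move=> if_; apply: (L1_le _ if_).
  by apply: measurable_maxr => //; exact: L1_measurable.
by move=> x; have [h|h] := leP 0 (f x); rewrite ?lexx// normr0.
Qed.

Lemma L1_huber e f : 0 < e -> L1 f -> L1 (fun x => huber e (f x)).
Proof.
move=> e0 if_; apply: (L1_le _ if_) => [|x].
  by apply: measurableT_comp; [exact: measurable_huber|exact: L1_measurable].
by rewrite ger0_norm ?huber_ge0 ?huber_le_norm.
Qed.

Lemma clamp_test e f : measurable_fun [set: T] f ->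
  is_test (fun x => clamp e (f x)).
Proof.
split; last by move=> x; exact: clamp_itv.
by apply: measurableT_comp => //; exact: measurable_clamp.
Qed.

Lemma L1_test_sqrdist phi psi : is_test phi -> is_test psi ->
  L1 (fun x => (phi x - psi x) ^+ 2).
Proof.
move=> [mphi phi01] [mpsi psi01]; apply: (L1_le _ (L1_cst 1)) => [|x].
  by apply: measurable_funX; exact: measurable_funB.
rewrite normrX normr1 exprn_ile1// ler_norml.
by have /andP[? ?] := phi01 x; have /andP[? ?] := psi01 x; lra.
Qed.

(** * Near-minimisers of the smoothed distance *)

Section near_minimisers.
Variables (q : T -> R) (D : set (T -> R)) (e m : R).
Hypotheses (iq : L1 q) (D_L1 : forall f, D f -> L1 f) (e0 : 0 < e).
Hypothesis D_convex : forall f g t, D f -> D g -> 0 <= t <= 1 ->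
  D (fun x => (1 - t) * f x + t * g x).

Let J f := \int[nu]_x huber e (q x - f x).
Let psi f x := clamp e (q x - f x).

Hypothesis m_le : forall f, D f -> m <= J f.

Let psi_test f : D f -> is_test (psi f).
Proof. by move=> Df; apply/clamp_test/L1_measurable/L1B => //; exact: D_L1. Qed.

Let J_L1 f : D f -> L1 (fun x => huber e (q x - f x)).
Proof. by move=> Df; apply: L1_huber => //; apply: L1B => //; exact: D_L1. Qed.

(* Since the gradient of [huber e] is [clamp e], this makes the tests [psi f]
   of near-minimisers [f] of [J] a Cauchy family in L^2. *)
Lemma near_minimisers_cauchy f g : D f -> D g ->
  e / 4 * \int[nu]_x (psi f x - psi g x) ^+ 2 <= J f + J g - 2 * m.
Proof.
move=> Df Dg; pose h x := (1 - 2^-1) * f x + 2^-1 * g x.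
have Dh : D h by apply: D_convex => //; lra.
have ifg := L1_test_sqrdist (psi_test Df) (psi_test Dg).
have iu := L1Z (e / 4) ifg; have iv := L1Z 2 (J_L1 Dh).
rewrite -RintegralZl//.
suff: \int[nu]_x (e / 4 * (psi f x - psi g x) ^+ 2)
   + 2 * J h <= J f + J g by have := m_le Dh; lra.
rewrite -[2 * _]RintegralZl//; last exact: J_L1.
rewrite -!RintegralD//; [|exact: J_L1..].
apply: le_Rintegral => //; [exact: L1D|by apply: L1D; exact: J_L1|].
move=> x _; apply: le_trans (huber_midpoint _ _ e0).
by rewrite le_eqVlt; apply/orP; left; apply/eqP; congr (_ + 2 * huber e _);
  rewrite /h; field.
Qed.

(** Ensures that a small step [t] from a near-minimiser [f] towards a fixed [g] stays
    near-minimising. *)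
Lemma near_minimiser_convex f g t : D f -> D g -> 0 <= t <= 1 ->
  J (fun x => (1 - t) * f x + t * g x) <= (1 - t) * J f + t * J g.
Proof.
move=> Df Dg t01; have Dh := D_convex Df Dg t01.
have iu := L1Z (1 - t) (J_L1 Df); have iv := L1Z t (J_L1 Dg).
rewrite /J -!RintegralZl//; [|exact: J_L1..].
rewrite -RintegralD//; apply: le_Rintegral => //; [exact: J_L1|exact: L1D|].
move=> x _; apply: le_trans (huber_convex _ _ e0 t01).
by rewrite le_eqVlt; apply/orP; left; apply/eqP; congr (huber e _); ring.
Qed.

(* Optimality at the near-minimiser [f] in the direction of [g]; taking the
   gradient at the intermediate point avoids any second-order term in [g - f],
   which is only in L^1. *)
Lemma near_minimiser_separates f g t : D f -> D g -> 0 < t <= 1 ->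
  m - (J f - m) / t <=
    \int[nu]_x (psi (fun y => (1 - t) * f y + t * g y) x * (q x - g x)).
Proof.
move=> Df Dg /andP[t0 t1]; set h := fun y => (1 - t) * f y + t * g y.
have t01 : 0 <= t <= 1 by rewrite (ltW t0).
have Dh : D h by exact: D_convex.
have iqh := L1B iq (D_L1 Dh); have igf := L1B (D_L1 Dg) (D_L1 Df).
have iqg := L1B iq (D_L1 Dg).
have tpsi := psi_test Dh.
have mh := m_le Dh.
(* Tangent inequality at [q - h], where [(q - f) - (q - h) = t * (g - f)]; the square is dropped. *)
have tan : J h + t * \int[nu]_x (psi h x * (g x - f x)) <= J f.
  rewrite -[t * _]RintegralZl//; last exact: L1_testM.
  have i1 := L1Z t (L1_testM tpsi igf).
  rewrite -RintegralD//; last exact: J_L1.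
  apply: le_Rintegral => //; [by apply: L1D => //; exact: J_L1|exact: J_L1|].
  move=> x _; apply: le_trans (huber_tangent _ (q x - h x) e0).
  rewrite /psi /h; set c := clamp e _.
  by have := mulr_ge0 (ltW e0) (sqr_ge0 (clamp e (q x - f x) - c)); lra.
have Jle : J h <= \int[nu]_x (psi h x * (q x - h x)).
  apply: le_Rintegral => //; [exact: J_L1|exact: L1_testM|].
  by move=> x _; exact: huber_le_clampM.
(* Pointwise, [q - g = (q - h) - (1 - t) * (g - f)]. *)
have -> : \int[nu]_x (psi h x * (q x - g x)) =
    \int[nu]_x (psi h x * (q x - h x))
    - (1 - t) * \int[nu]_x (psi h x * (g x - f x)).
  rewrite -RintegralZl//; last exact: L1_testM.
  rewrite -RintegralB//; [|exact: L1_testM|by apply: L1Z; exact: L1_testM].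
  by apply: eq_Rintegral => x _; rewrite /h; ring.
set I := (X in (1 - t) * X); have tI : I <= (J f - m) / t.
  by rewrite ler_pdivlMr// mulrC -/I; move: tan; rewrite -/I; lra.
(* [I] may have either sign; since its upper bound is nonnegative, that bound also holds for
   [(1 - t) * I]. *)
have fm : 0 <= (J f - m) / t.
  by rewrite divr_ge0 ?(ltW t0)// subr_ge0 m_le.
have : (1 - t) * I <= (J f - m) / t by nra.
by lra.
Qed.

End near_minimisers.
End real_integrals.

(** * Almost everywhere convergence of tests *)

Section test_limits.
Context d (T : measurableType d) (R : realType).
Variable nu : {finite_measure set T -> \bar R}.
Local Open Scope ring_scope.
Implicit Types f g phi : T -> R.

Local Notation L1 f := (nu.-integrable [set: T] (EFin \o f)).

Lemma Rintegral_test_cvg (phi_ : nat -> T -> R) phi h :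
  (forall k, is_test (phi_ k)) -> is_test phi -> L1 h ->
  {ae nu, forall x, phi_ k x @[k --> \oo] --> phi x} ->
  \int[nu]_x (phi_ k x * h x) @[k --> \oo] --> \int[nu]_x (phi x * h x).
Proof.
move=> tphi_ tphi ih cphi.
have im k := L1_testM (tphi_ k) ih; have i0 := L1_testM tphi ih.
have [||||_ _ c] := @dominated_convergence _ _ _ nu _ measurableT
    (fun k => EFin \o (fun x => phi_ k x * h x)) (EFin \o (fun x => phi x * h x))
    (EFin \o (fun x => `|h x|)) (fun k => measurable_int _ (im k)).
- exact: measurable_int i0.
- apply: filterS cphi => x cx _; apply: cvg_EFin; first exact: nearW.
  by apply: cvgM => //; exact: cvg_cst.
- exact: integrable_norm.
- apply: aeW => x k _; rewrite /= lee_fin normrM ler_piMl//.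
  by have [_ /(_ x)/andP[? ?]] := tphi_ k; rewrite ger0_norm.
- apply: fine_cvg; rewrite fineK//; exact: integrable_fin_num.
Qed.

(** As [nu] is finite, AM-GM turns squared L^2 distances of order [4^-1 ^+ k] into L^1 distances of
    order [2^-1 ^+ k]. Their sum then has a finite integral, hence is finite almost everywhere. *)
Lemma ae_summable_test_dist (phi psi : nat -> T -> R) (C : R) :
  (forall k, is_test (phi k)) -> (forall k, is_test (psi k)) ->
  (forall k, \int[nu]_x (phi k x - psi k x) ^+ 2 <= C * 4^-1 ^+ k) ->
  {ae nu, forall x, cvgn (series (fun k => `|phi k x - psi k x|))}.
Proof.
move=> tphi tpsi le_C; pose g k x := `|phi k x - psi k x|.
have isq k := L1_test_sqrdist nu (tphi k) (tpsi k).
have mB k : measurable_fun [set: T] (fun x => phi k x - psi k x).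
  by apply: measurable_funB; [exact: (tphi k).1|exact: (tpsi k).1].
have mg k : measurable_fun [set: T] (g k) by exact: measurableT_comp.
have g0 k x : 0 <= g k x by exact: normr_ge0.
have g1 k x : g k x <= 1.
  rewrite ler_norml; have [_ /(_ x)/andP[? ?]] := tphi k.
  by have [_ /(_ x)/andP[? ?]] := tpsi k; lra.
have ig k : L1 (g k).
  by apply: (L1_le _ (L1_cst nu 1)) => // x; rewrite normr_id normr1; exact: g1.
have g_le k : \int[nu]_x g k x <= (fine (nu setT) + C) * 2^-1 ^+ k.
  have iu := L1_cst nu (2^-1 ^+ k : R); have iv := L1Z (2 ^+ k) (isq k).
  apply: (@le_trans _ _ (\int[nu]_x (2^-1 ^+ k + 2 ^+ k * (phi k x - psi k x) ^+ 2))).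
    apply: le_Rintegral => //; first exact: L1D.
    (* AM-GM: [2 * `|a| <= c^-1 + c * a ^+ 2] with [c = 2 ^+ k] *)
    move=> x _; rewrite /g; set a := phi k x - psi k x.
    have c0 : 0 < 2 ^+ k :> R by exact: exprn_gt0.
    have <- : (2 ^+ k)^-1 = 2^-1 ^+ k :> R by rewrite exprVn.
    rewrite -[a ^+ 2]real_normK ?num_real//; move: (normr_ge0 a); move: `|a| => b b0.
    have := sqr_ge0 ((2 ^+ k)^-1 - b); rewrite -(pmulr_rge0 _ c0).
    have -> : 2 ^+ k * ((2 ^+ k)^-1 - b) ^+ 2 = (2 ^+ k)^-1 - 2 * b + 2 ^+ k * b ^+ 2.
      by field; rewrite gt_eqF.
    lra.
  rewrite RintegralD// RintegralZl// Rintegral_cst// mulrDl mulrC lerD2l.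
  rewrite mulrC -ler_pdivlMr ?exprn_gt0// -mulrA -exprVn -exprMn.
  by rewrite (_ : 2^-1 * 2^-1 = 4^-1 :> R)//; field.
(* No sign is assumed on [C]; the case [k = 0] of [g_le] supplies the one needed for the geometric
   bound. *)
have C0 : 0 <= fine (nu setT) + C.
  have := g_le 0%N; rewrite expr0 mulr1; apply: le_trans.
  by apply: Rintegral_ge0 => x _; exact: normr_ge0.
pose S x := (\sum_(k <oo) (g k x)%:E)%E.
have mEg k : measurable_fun [set: T] (EFin \o g k) by exact/measurable_EFinP.
have S0 x : (0 <= S x)%E by apply: nneseries_ge0 => k _ _; rewrite lee_fin.
have iS : nu.-integrable [set: T] S.
  apply/integrableP; split.
    by apply: ge0_emeasurable_sum => [k x _ _|k _]; [rewrite lee_fin|exact: mEg].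
  under eq_integral do rewrite gee0_abs//.
  rewrite integral_nneseries//; last by move=> k x _; rewrite lee_fin.
  apply: (@le_lt_trans _ _ ((fine (nu setT) + C) * (1 - 2^-1)^-1)%:E); last exact: ltry.
  apply: lime_le.
    by apply: is_cvg_nneseries => k _ _; apply: integral_ge0 => x _; rewrite lee_fin.
  apply: nearW => n.
  have h1 : `|2^-1 : R| < 1 by rewrite ger0_norm// invf_lt1// ltr1n.
  have h2 : 0 < 2^-1 :> R by rewrite invr_gt0.
  have := geometric_le_lim n C0 h2 h1.
  rewrite -lee_fin; apply: le_trans; rewrite /series/= -sumEFin.
  apply: lee_sum => k _ /=.
  rewrite -[leLHS]fineK; last by apply: integrable_fin_num => //; exact: ig.
  by rewrite lee_fin; exact: g_le.
have := integrable_ae measurableT iS; apply: filterS => x /(_ Logic.I) Sfin.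
apply: nondecreasing_is_cvgn.
  by apply/nondecreasing_seqP => n; rewrite /series/= big_nat_recr//= lerDl.
exists (fine (S x)) => _ [n _ <-]; rewrite -lee_fin fineK// /series/= -sumEFin.
by apply: nneseries_lim_ge => k _ _; rewrite lee_fin.
Qed.

End test_limits.

(** [clamp 1] will truncate a pointwise limit into a test without altering values already in the
    unit interval. *)
Lemma clamp1_id (R : realType) (u : R) : (0 <= u <= 1)%R -> clamp 1 u = u.
Proof. by move=> /andP[u0 u1]; rewrite /clamp divr1 (min_idPr u1) (max_idPr u0). Qed.

(** * Separation of a point from a convex set in L^1 by a test *)

Section separation.
Context d (T : measurableType d) (R : realType).
Variable nu : {finite_measure set T -> \bar R}.
Local Open Scope ring_scope.

Local Notation L1 f := (nu.-integrable [set: T] (EFin \o f)).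

Theorem L1_test_separation (q : T -> R) (D : set (T -> R)) (delta : R) :
  L1 q -> (forall f, D f -> L1 f) -> D !=set0 ->
  (forall f g t, D f -> D g -> 0 <= t <= 1 ->
     D (fun x => (1 - t) * f x + t * g x)) ->
  0 < delta ->
  (forall f, D f -> delta <= \int[nu]_x Num.max 0 (q x - f x)) ->
  exists phi c, [/\ is_test phi, 0 < c &
    forall g, D g -> c <= \int[nu]_x (phi x * (q x - g x))].
Proof.
move=> iq D_L1 [f0 Df0] D_convex delta0 D_far.
pose N := fine (nu [set: T]); have N0 : 0 <= N by exact: fine_ge0.
(* The total smoothing loss [e / 2 * N] is then at most [delta / 2]; the [+ 1] covers a zero
   measure. *)
pose e := delta / (N + 1); have e0 : 0 < e by rewrite divr_gt0// ltr_wpDl.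
pose J f := \int[nu]_x huber e (q x - f x).
have J_ge f : D f -> delta / 2 <= J f.
  move=> Df; have iqf := L1B iq (D_L1 _ Df).
  have : \int[nu]_x (Num.max 0 (q x - f x) - e / 2) <= J f.
    apply: le_Rintegral => //; [|exact: L1_huber|].
      by apply: L1B; [exact: L1_pos|exact: L1_cst].
    by move=> x _; exact: huber_ge_pos.
  rewrite RintegralB//; [|exact: L1_pos|exact: L1_cst].
  rewrite Rintegral_cst// -/N; apply: le_trans.
  have : e * N <= delta.
    by rewrite /e -mulrA ler_piMr ?(ltW delta0)// mulrC ler_pdivrMr ?mul1r ?lerDl// ltr_wpDl.
  have := D_far f Df; lra.
pose V := [set J f | f in D]; pose m := inf V.
have hV : has_inf V.
  split; first by exists (J f0), f0.
  by exists (delta / 2) => _ [f Df <-]; exact: J_ge.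
have m_le f : D f -> m <= J f.
  by move=> Df; apply: ge_inf; [exact: hV.2|exact: imageP].
have m0 : 0 < m.
  apply: (@lt_le_trans _ _ (delta / 2)); first by rewrite divr_gt0.
  by apply: lb_le_inf; [exact: hV.1|move=> _ [f Df <-]; exact: J_ge].
(* The accuracy [16^-1 ^+ k] is chosen so that, with the step [t = 4^-1 ^+ k]
   below, both [16^-1 ^+ k / t] and the L^2 distances are geometric. *)
have f_ex k : exists f, D f /\ J f < m + 16^-1 ^+ k.
  have [|_ [f Df <-] ?] := @inf_adherent _ V (16^-1 ^+ k) _ hV; last by exists f.
  by rewrite exprn_gt0.
have [f_ /all_and2[Df_ Jf_]] := choice f_ex.
pose psi f x := clamp e (q x - f x).
have psi_test f : D f -> is_test (psi f).
  by move=> Df; apply/clamp_test/(@L1_measurable _ _ _ nu)/L1B => //; exact: D_L1.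
have e4 : 0 < 4 / e by exact: divr_gt0.
have cauchy f g : D f -> D g ->
    \int[nu]_x (psi f x - psi g x) ^+ 2 <= 4 / e * (J f + J g - 2 * m).
  move=> Df Dg.
  have := near_minimisers_cauchy iq D_L1 e0 D_convex m_le Df Dg.
  rewrite -(ler_pM2l e4) mulrA.
  by rewrite (_ : 4 / e * (e / 4) = 1) ?mul1r//; field; rewrite gt_eqF.
have pow16 k : 16^-1 ^+ k <= 4^-1 ^+ k :> R.
  by apply: lerXn2r; rewrite ?nnegrE ?invr_ge0// lef_pV2 ?posrE// ler_nat.
have pow4 k : 0 < 4^-1 ^+ k :> R by rewrite exprn_gt0.
have pow4_1 k : 4^-1 ^+ k <= 1 :> R by rewrite exprn_ile1// invf_le1// ler1n.
(* The factor 2 comes from the excesses of [f_ k] and [f_ k.+1], each at most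
   [16^-1 ^+ k <= 4^-1 ^+ k]. *)
have sum1 := @ae_summable_test_dist _ _ _ nu (fun k => psi (f_ k.+1))
  (fun k => psi (f_ k)) (4 / e * 2) (fun k => psi_test _ (Df_ k.+1))
  (fun k => psi_test _ (Df_ k)).
have {}sum1 : {ae nu, forall x,
    cvgn (series (fun k => `|psi (f_ k.+1) x - psi (f_ k) x|))}.
  apply: sum1 => k; apply: (le_trans (cauchy _ _ (Df_ _) (Df_ _))).
  rewrite -[leRHS]mulrA ler_pM2l//.
  have := Jf_ k; have := Jf_ k.+1; have := pow16 k.
  have : 16^-1 ^+ k.+1 <= 16^-1 ^+ k :> R.
    by rewrite exprS ler_piMl ?exprn_ge0 ?invr_ge0// invf_le1// ler1n.
  lra.
(* The upper limit is measurable and defined everywhere, and agrees with the limit wherever that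
   exists. *)
pose phi x := clamp 1 (fine (limn_esup (fun k => (psi (f_ k) x)%:E))).
have phi_test : is_test phi.
  apply: clamp_test; apply: measurableT_comp => //.
  apply: measurable_fun_limn_esup => k; apply/measurable_EFinP.
  exact: (psi_test _ (Df_ k)).1.
have phi_cvg : {ae nu, forall x, psi (f_ k) x @[k --> \oo] --> phi x}.
  apply: filterS sum1 => x sx.
  (* Absolutely summable increments telescope to a convergent sequence. *)
  have cx : cvgn (fun k => psi (f_ k) x).
    have := @normed_cvg _ _ (telescope (fun k => psi (f_ k) x)) sx.
    rewrite telescopeK => c.
    have -> : (fun k => psi (f_ k) x) =
        (fun k => (psi (f_ k) x - psi (f_ 0%N) x) + psi (f_ 0%N) x).
      by apply/funext => k; rewrite subrK.
    by apply: is_cvgD => //; exact: is_cvg_cst.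
  have lx : limn_esup (fun k => (psi (f_ k) x)%:E) = (limn (fun k => psi (f_ k) x))%:E.
    have cE : (psi (f_ k) x)%:E @[k --> \oo] --> (limn (fun k => psi (f_ k) x))%:E.
      by apply: cvg_EFin => //; exact: nearW.
    by rewrite is_cvg_limn_esupE; [exact/cvg_lim|exact: cvgP cE].
  rewrite /phi lx /= clamp1_id//; apply/andP; split.
    by apply: limr_ge => //; apply: nearW => k; have [_ /(_ x)/andP[]] := psi_test _ (Df_ k).
  by apply: limr_le => //; apply: nearW => k; have [_ /(_ x)/andP[]] := psi_test _ (Df_ k).
exists phi, m; split => // g Dg.
pose t k : R := 4^-1 ^+ k.
have t01 k : 0 < t k <= 1 by rewrite pow4 pow4_1.
have t01' k : 0 <= t k <= 1 by have /andP[/ltW-> ->] := t01 k.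
pose h k x := (1 - t k) * f_ k x + t k * g x.
have Dh k : D (h k) by exact: D_convex.
have J0 : 0 <= J g by apply: le_trans (m_le _ Dg); exact: ltW.
(* Shows that the perturbed tests have the same limit [phi]. By convexity
   [J (h k) + J (f_ k) - 2 * m] is at most [2 * 16^-1 ^+ k + t k * J g], whence the constant
   [2 + J g]. *)
have sum2 : {ae nu, forall x, cvgn (series (fun k => `|psi (h k) x - psi (f_ k) x|))}.
  apply: (@ae_summable_test_dist _ _ _ nu _ _ (4 / e * (2 + J g))) => k; [exact: psi_test..|].
  apply: (le_trans (cauchy _ _ (Dh _) (Df_ _))).
  rewrite -[leRHS]mulrA ler_pM2l//.
  have := near_minimiser_convex iq D_L1 e0 D_convex (Df_ k) Dg (t01' k).
  rewrite -/(J _) -/(J _) -/(J _) -/(h k) -/(t k) => Jh.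
  have := Jf_ k; have := pow16 k; rewrite -/(t k).
  have := mulr_ge0 (ltW (pow4 k)) (le_trans (ltW m0) (m_le _ (Df_ k))).
  rewrite -/(t k); lra.
have psi_cvg : {ae nu, forall x, psi (h k) x @[k --> \oo] --> phi x}.
  apply: filterS2 phi_cvg sum2 => x px /cvg_series_cvg_0 /norm_cvg0P c.
  rewrite -[phi x]add0r.
  have -> : (fun k => psi (h k) x) =
      (fun k => (psi (h k) x - psi (f_ k) x) + psi (f_ k) x).
    by apply/funext => k; rewrite subrK.
  exact: cvgD.
have lim := Rintegral_test_cvg (fun k => psi_test _ (Dh k)) phi_test
  (L1B iq (D_L1 _ Dg)) psi_cvg.
have low k : m - 4^-1 ^+ k <= \int[nu]_x (psi (h k) x * (q x - g x)).
  have := near_minimiser_separates iq D_L1 e0 D_convex m_le (Df_ k) Dg (t01 k).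
  apply: le_trans; rewrite lerD2l lerN2 ler_pdivrMr ?pow4//.
  rewrite -exprMn (_ : 4^-1 * 4^-1 = 16^-1 :> R); last by field.
  by have := Jf_ k; rewrite -/(J _); lra.
have lim0 : m - 4^-1 ^+ k @[k --> \oo] --> m.
  rewrite -[X in _ --> X]subr0; apply: cvgB; first exact: cvg_cst.
  have := @cvg_geometric R 1 4^-1.
  under [X in (_ -> X @ _ --> _) -> _]eq_fun do rewrite /geometric/= mul1r.
  by apply; rewrite ger0_norm ?invr_ge0// invf_lt1// ltr1n.
by apply: (ler_cvg_to lim0 lim); exact: nearW.
Qed.

End separation.

(** * Reduction to a finite dominating measure *)

Section dominating_finite_measure.
Context d (T : measurableType d) (R : realType).

(** Restrict [mu] to the pieces [F i] of finite measure and sum with weights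
    [2^-1 ^+ i / (1 + mu (F i))]: the total mass is at most 2, and a null set of the sum is
    [mu]-null on every piece. *)
Lemma finite_measure_dominating (mu : {sigma_finite_measure set T -> \bar R}) :
  exists nu : {finite_measure set T -> \bar R}, mu `<< nu.
Proof.
have [F TF /all_and2[mF muFoo]] := sigma_finiteT mu.
have fin0 i : (0 <= fine (mu (F i)))%R by exact: fine_ge0.
have r0 i : (0 < 2^-1 ^+ i / (1 + fine (mu (F i))) :> R)%R.
  by rewrite divr_gt0 ?exprn_gt0 ?invr_gt0// ltr_pwDl.
pose m_ i : {measure set T -> \bar R} :=
  mscale (NngNum (ltW (r0 i))) (mrestr mu (mF i)).
have m_E i A : m_ i A =
    (2^-1 ^+ i / (1 + fine (mu (F i))))%:E * mu (A `&` F i) by [].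
pose nu0 : {measure set T -> \bar R} := mseries m_ 0.
have nu0_fin : fin_num_fun nu0.
  apply: lty_fin_num_fun.
  apply: (@le_lt_trans _ _ ((1 * (1 - 2^-1)^-1)%R%:E)); last exact: ltry.
  apply: lime_le; first by apply: is_cvg_nneseries => k _ _; exact: measure_ge0.
  apply: nearW => n.
  have h1 : (`|2^-1 : R| < 1)%R by rewrite ger0_norm// invf_lt1// ltr1n.
  have h2 : (0 < 2^-1 :> R)%R by rewrite invr_gt0.
  have := geometric_le_lim n ler01 h2 h1.
  rewrite -lee_fin; apply: le_trans; rewrite /series/= -sumEFin.
  apply: lee_sum => k _; rewrite m_E setTI.
  have muK : mu (F k) = (fine (mu (F k)))%:E by rewrite fineK// ge0_fin_numE//; exact: muFoo.
  rewrite [X in _ * X]muK lee_fin mul1r -mulrA ler_piMr ?exprn_ge0 ?invr_ge0//.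
  rewrite mulrC ler_pdivrMr ?mul1r ?lerDr//.
  exact: ltr_pwDl.
pose fin := Measure_isFinite.Build _ _ _ nu0 nu0_fin.
pose nu : {finite_measure set T -> \bar R} := HB.pack (Measure.sort nu0) (Measure.class nu0) fin.
exists nu; apply/null_content_dominatesP => A mA nuA0.
have muAF i : mu (A `&` F i) = 0.
  have : m_ i A <= 0.
    rewrite -nuA0; apply: (@le_trans _ _ (\sum_(0 <= k < i.+1) m_ k A)).
      by rewrite big_nat_recr//= leeDr// sume_ge0.
    by apply: nneseries_lim_ge => k _ _; exact: measure_ge0.
  rewrite m_E pmule_rle0 ?lte_fin// => le0.
  by apply/eqP; rewrite eq_le le0 measure_ge0.
apply/eqP; rewrite eq_le measure_ge0 andbT -[A]setIT TF setI_bigcupr.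
have mAF i : measurable (A `&` F i) by exact: measurableI.
apply: le_trans (measure_sigma_subadditive mu mAF _ _) _ => //.
  exact: bigcup_measurable.
by rewrite eseries0// => i _ _; exact: muAF.
Qed.

End dominating_finite_measure.

(** * Finite mixtures and the convex hull *)

Section mixtures.
Context d (T : measurableType d) (R : realType).
Implicit Types P Q : probability T R.

Lemma indic_test (B : set T) : measurable B -> is_test (\1_B : T -> R).
Proof.
move=> mB; split; first exact: measurable_indic.
by move=> x; rewrite indicE; case: (_ \in _); rewrite !lexx ler01.
Qed.

Lemma expectation_indicT P (B : set T) : measurable B -> 'E_P[\1_B] = P B.
Proof. by move=> mB; rewrite unlock integral_indic// setIT. Qed.

(* [`|a i|] stands for [a i]: [mscale] needs a nonnegative scalar. *)
Definition mixture N (a : 'I_N -> R) (Ps : 'I_N -> probability T R) :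
    {measure set T -> \bar R} :=
  msum (fun k => if insub k is Some i then mscale (`|a i|%:nng)%R (Ps i)
                 else mzero) N.

Lemma mixtureE N (a : 'I_N -> R) (Ps : 'I_N -> probability T R) B : (forall i, 0 <= a i)%R ->
  mixture a Ps B = \sum_(i < N) (a i)%:E * Ps i B.
Proof.
move=> a0; rewrite /mixture/= /msum; apply: eq_bigr => i _.
by rewrite valK /= /mscale/= ger0_norm.
Qed.

Lemma expectation_mixture N (a : 'I_N -> R) (Ps : 'I_N -> probability T R) P phi :
  (forall i, 0 <= a i)%R -> is_test phi ->
  (forall B, measurable B -> P B = \sum_(i < N) (a i)%:E * Ps i B) ->
  'E_P[phi] = \sum_(i < N) (a i)%:E * 'E_(Ps i)[phi].
Proof.
move=> a0 [mphi phi01] PE; rewrite unlock.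
have mE : measurable_fun [set: T] (EFin \o phi) by exact/measurable_EFinP.
have phi0 x : 0 <= (phi x)%:E by rewrite lee_fin; case/andP: (phi01 x).
rewrite (@eq_measure_integral _ _ _ _ (mixture a Ps)); last first.
  by move=> B mB _; rewrite /= mixtureE// PE.
rewrite ge0_integral_measure_sum//; apply: eq_bigr => i _.
by rewrite valK ge0_integral_mscale//= ger0_norm.
Qed.

Lemma mixture_probability N (a : 'I_N -> R) (Ps : 'I_N -> probability T R) :
  (forall i, 0 <= a i)%R -> (\sum_(i < N) a i = 1)%R ->
  exists P : probability T R, forall B, P B = \sum_(i < N) (a i)%:E * Ps i B.
Proof.
move=> a0 a1.
have T1 : mixture a Ps [set: T] = 1.
  rewrite mixtureE//; under eq_bigr do rewrite probability_setT mule1.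
  by rewrite sumEFin a1.
pose isP := Measure_isProbability.Build _ _ _ (mixture a Ps) T1.
pose P : probability T R :=
  HB.pack (Measure.sort (mixture a Ps)) (Measure.class (mixture a Ps)) isP.
by exists P => B; rewrite -mixtureE.
Qed.

(** Concatenate the two families, with weights [(1 - t) * a i] and [t * b j]. The conclusion is
    about tests because [density] is. *)
Lemma co_convex (PP : set (probability T R)) P Q (t : R) :
  co PP P -> co PP Q -> (0 <= t <= 1)%R ->
  exists2 M, co PP M & forall phi, is_test phi ->
    'E_M[phi] = (1 - t)%:E * 'E_P[phi] + t%:E * 'E_Q[phi].
Proof.
move=> [N [a [Ps [a01 a1 PPs PE]]]] [N' [b [Qs [b01 b1 PQs QE]]]] /andP[t0 t1].
have t1' : (0 <= 1 - t)%R by rewrite subr_ge0.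
have a0 i : (0 <= a i)%R by case/andP: (a01 i).
have b0 i : (0 <= b i)%R by case/andP: (b01 i).
pose ab (k : 'I_(N + N')) : R :=
  match fintype.split k with inl i => (1 - t) * a i | inr j => t * b j end%R.
pose PQ (k : 'I_(N + N')) :=
  match fintype.split k with inl i => Ps i | inr j => Qs j end.
have ab0 k : (0 <= ab k)%R.
  by rewrite /ab; case: fintype.split => i; exact: mulr_ge0.
have abl i : ab (lshift N' i) = ((1 - t) * a i)%R.
  by rewrite /ab (unsplitK (inl i)).
have abr i : ab (rshift N i) = (t * b i)%R by rewrite /ab (unsplitK (inr i)).
have PQl i : PQ (lshift N' i) = Ps i by rewrite /PQ (unsplitK (inl i)).
have PQr i : PQ (rshift N i) = Qs i by rewrite /PQ (unsplitK (inr i)).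
have ab1 : (\sum_k ab k = 1)%R.
  rewrite big_split_ord/=; under eq_bigr do rewrite abl.
  under [X in (_ + X)%R]eq_bigr do rewrite abr.
  by rewrite -!mulr_sumr a1 b1 !mulr1 subrK.
have [M ME] := mixture_probability PQ ab0 ab1.
exists M.
  exists (N + N')%N, ab, PQ; split=> //.
  - move=> k; rewrite ab0 -ab1 (bigD1 k)//= lerDl.
    by apply: sumr_ge0 => i _; exact: ab0.
  - by move=> k; rewrite /PQ; case: fintype.split => i.
move=> phi tphi.
rewrite (expectation_mixture ab0 tphi (fun B _ => ME B)).
rewrite (expectation_mixture a0 tphi PE) (expectation_mixture b0 tphi QE).
have E0 (X : probability T R) : 0 <= 'E_X[phi].
  by rewrite unlock; apply: integral_ge0 => x _; rewrite lee_fin; case/andP: (tphi.2 x).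
rewrite big_split_ord/= !ge0_sume_distrr.
- congr (_ + _); apply: eq_bigr => i _; first by rewrite abl PQl EFinM muleA.
  by rewrite abr PQr EFinM muleA.
- by move=> i _; rewrite mule_ge0 ?lee_fin.
- by move=> i _; rewrite mule_ge0 ?lee_fin.
Qed.

Lemma sub_co (PP : set (probability T R)) : PP `<=` co PP.
Proof.
move=> P PPP; exists 1%N, (fun=> 1%R), (fun=> P); split => //.
- by move=> _; rewrite ler01 lexx.
- by rewrite big_ord1.
- by move=> B _; rewrite big_ord1 mul1e.
Qed.

Lemma co_dominates (PP : set (probability T R)) (nu : {measure set T -> \bar R}) P :
  (forall Q, PP Q -> Q `<< nu) -> co PP P -> P `<< nu.
Proof.
move=> PPnu [N [a [Ps [a01 a1 PPs PE]]]].
apply/null_content_dominatesP => A mA nuA; rewrite PE// big1// => i _.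
by have /null_content_dominatesP -> := PPnu _ (PPs i); rewrite ?mule0.
Qed.

End mixtures.

(** * Densities, total variation and approximation *)

Section densities.
Context d (T : measurableType d) (R : realType).
Variable nu : {finite_measure set T -> \bar R}.
Implicit Types (P Q : probability T R) (f q phi : T -> R).

Local Notation L1 f := (nu.-integrable [set: T] (EFin \o f)).

(** Tests make convex combinations immediate; indicators recover the values on measurable sets. *)
Definition density P f := L1 f /\
  forall phi, is_test phi -> 'E_P[phi] = (\int[nu]_x (phi x * f x)%R)%R%:E.

Lemma density_exists P : P `<< nu -> exists f, density P f.
Proof.
move=> Pnu; pose D := Radon_Nikodym_SigmaFinite.f P nu.
have Dfin x : D x \is a fin_num by exact: Radon_Nikodym_SigmaFinite.f_fin_num.
have ED : EFin \o (fine \o D) = D by apply/funext => x /=; rewrite fineK.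
have iD : L1 (fine \o D).
  by rewrite ED; exact: Radon_Nikodym_SigmaFinite.f_integrable.
exists (fine \o D); split => // phi tphi.
have im := L1_testM tphi iD.
rewrite fineK; last exact: integrable_fin_num.
rewrite unlock -(Radon_Nikodym_SigmaFinite.change_of_variables Pnu)//.
- by apply: eq_integral => x _; rewrite EFinM /= fineK.
- by move=> x; rewrite lee_fin; case/andP: (tphi.2 x).
- by apply/measurable_EFinP; exact: tphi.1.
Qed.

Lemma densityB P Q f q phi : density P f -> density Q q -> is_test phi ->
  'E_Q[phi] - 'E_P[phi] = (\int[nu]_x (phi x * (q x - f x))%R)%R%:E.
Proof.
move=> [if_ Pf] [iq Qq] tphi; rewrite Pf// Qq// -EFinB -RintegralB//;
  [|exact: L1_testM..].
by congr EFin; apply: eq_Rintegral => x _; rewrite mulrBr.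
Qed.

Lemma densityB_set P Q f q B : density P f -> density Q q -> measurable B ->
  Q B - P B = (\int[nu]_x (\1_B x * (q x - f x))%R)%R%:E.
Proof.
move=> Pf Qq mB.
by rewrite -(densityB Pf Qq (indic_test _ mB)) !expectation_indicT.
Qed.

(** Integrating [q - f] over a set gives at most the integral of its positive part, with equality on
    the set where [f < q]. *)
Lemma dTV_density P Q f q : density P f -> density Q q ->
  dTV P Q = (\int[nu]_x (Num.max 0 (q x - f x))%R)%R%:E.
Proof.
move=> Pf Qq; have [if_ _] := Pf; have [iq _] := Qq.
have iqf := L1B iq if_.
have QP_le B : measurable B ->
    Q B - P B <= (\int[nu]_x (Num.max 0 (q x - f x))%R)%R%:E.
  move=> mB; rewrite (densityB_set Pf Qq mB) lee_fin.
  apply: le_Rintegral => //; [|exact: L1_pos|].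
    by apply: L1_testM => //; exact: indic_test.
  move=> x _; rewrite indicE; case: (_ \in _); rewrite ?mul1r ?mul0r le_max lexx//.
  by rewrite orbT.
apply/eqP; rewrite eq_le; apply/andP; split.
  apply: ge_ereal_sup => _ [B mB <-].
  have fP := fin_num_measure P B mB; have fQ := fin_num_measure Q B mB.
  (* The absolute value needs both signs; [P B - Q B] equals [Q - P] on the complement of [B]. *)
  rewrite -(fineK fP) -(fineK fQ) -EFinB /= lee_fin ler_norml.
  have := QP_le B mB; have := QP_le (~` B) (measurableC mB).
  rewrite !probability_setC// -(fineK fP) -(fineK fQ) -!EFinB !lee_fin.
  lra.
pose B := [set x | (f x)%:E < (q x)%:E].
have mB : measurable B.
  rewrite -[B]setTI; apply: measurable_lte => //.
  - exact: measurable_int if_.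
  - exact: measurable_int iq.
apply: (@le_trans _ _ `|P B - Q B|); last by apply: ereal_sup_ubound; exists B.
have -> : `|P B - Q B| = `|Q B - P B|.
  rewrite -(fineK (fin_num_measure P B mB)) -(fineK (fin_num_measure Q B mB)).
  by rewrite -!EFinB /= distrC.
apply: le_trans (lee_abs _); rewrite (densityB_set Pf Qq mB) lee_fin.
rewrite le_eqVlt; apply/orP; left; apply/eqP; apply: eq_Rintegral => x _.
rewrite indicE; have [xB|xB] := boolP (x \in B).
  by move: xB; rewrite inE mul1r /B/= lte_fin => /ltW; rewrite -subr_ge0 => /max_idPr.
rewrite mul0r; apply/max_idPl; rewrite subr_le0 leNgt; apply/negP => fq.
by move/negP: xB; apply; rewrite inE /B/= lte_fin.
Qed.

Lemma expectation_le_dTV P Q phi : P `<< nu -> Q `<< nu -> is_test phi ->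
  'E_Q[phi] <= 'E_P[phi] + dTV P Q.
Proof.
move=> /density_exists[f Pf] /density_exists[q Qq] tphi.
have [if_ Pphi] := Pf; have [iq _] := Qq; have iqf := L1B iq if_.
rewrite -leeBlDl; last by rewrite Pphi.
rewrite (densityB Pf Qq tphi) (dTV_density Pf Qq) lee_fin.
apply: le_Rintegral => //; [exact: L1_testM|exact: L1_pos|].
move=> x _; have /andP[p0 p1] := tphi.2 x.
by have [h|h] := leP 0%R (q x - f x)%R; [rewrite ler_piMl|rewrite mulr_ge0_le0// ltW].
Qed.

Variable PP : set (probability T R).
Hypotheses (PPnu : forall P, PP P -> P `<< nu) (PP_neq0 : PP !=set0).

Lemma expectation_co_le phi P : is_test phi -> co PP P ->
  'E_P[phi] <= ereal_sup [set 'E_P[phi] | P in PP].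
Proof.
move=> tphi [N [a [Ps [a01 a1 PPs PE]]]].
have a0 i : (0 <= a i)%R by case/andP: (a01 i).
rewrite (expectation_mixture a0 tphi PE).
set S := ereal_sup _.
have le_S i : 'E_(Ps i)[phi] <= S by apply: ereal_sup_ubound; exists (Ps i).
apply: (@le_trans _ _ (\sum_(i < N) (a i)%:E * S)).
  by apply: lee_sum => i _; rewrite lee_wpmul2l ?lee_fin.
rewrite -ge0_sume_distrl; last by move=> i _; rewrite lee_fin.
by rewrite sumEFin a1 mul1e.
Qed.

(** Otherwise the densities of [co PP] are at L^1 distance at least [eps] from [q], in the sense of
    positive parts, and the separating test keeps every expectation over [PP] at least [c] below
    that of [Q]. *)
Lemma co_dTV_approx Q (eps : R) : Q `<< nu -> (0 < eps)%R ->
  (forall phi, is_test phi -> 'E_Q[phi] <= ereal_sup [set 'E_P[phi] | P in PP]) ->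
  exists2 P, co PP P & dTV P Q < eps%:E.
Proof.
move=> /density_exists[q Qq] eps0 testQ; apply: contrapT => far.
have [iq Qphi] := Qq.
pose D := [set f | exists2 P, co PP P & density P f].
have [P0 PP0] := PP_neq0.
have [||||phi [c [tphi c0 sep]]] := @L1_test_separation _ _ _ nu q D eps iq _ _ _ eps0.
- by move=> f [P _ []].
- have [f Pf] := density_exists (PPnu PP0).
  by exists f, P0 => //; exact: sub_co.
- move=> f g t [P cP Pf] [P' cP' Pg] t01.
  have [M cM ME] := co_convex cP cP' t01.
  exists M => //; have [if_ Pphi] := Pf; have [ig Pphi'] := Pg.
  have i1 := L1Z (1 - t) if_; have i2 := L1Z t ig.
  split; first exact: L1D.
  move=> phi tphi; rewrite ME// Pphi// Pphi'// -!EFinM -EFinD.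
  rewrite -!RintegralZl//; [|exact: L1_testM..].
  rewrite -RintegralD//; [|by apply: L1Z; exact: L1_testM..].
  by congr EFin; apply: eq_Rintegral => x _; ring.
- move=> f [P cP Pf]; rewrite leNgt; apply/negP => lt_eps; apply: far.
  by exists P => //; rewrite (dTV_density Pf Qq) lte_fin.
have := testQ _ tphi; apply/negP; rewrite -ltNge.
apply: (@le_lt_trans _ _ ('E_Q[phi] - c%:E)); last first.
  by rewrite Qphi// -EFinB lte_fin ltrBlDr ltrDl.
apply: ge_ereal_sup => _ [P PPP <-].
have [f Pf] := density_exists (PPnu PPP).
have := sep f (ex_intro2 _ _ P (sub_co PPP) Pf).
have [_ Pphi] := Pf.
by rewrite -lee_fin -(densityB Pf Qq tphi) Pphi// Qphi// -!EFinB !lee_fin; lra.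
Qed.

End densities.

(** * The equivalence *)

Theorem corollary1 (R : realType) (n l : nat)
    (Z : set 'M[R]_(n, l)) (Z_neq0 : Z !=set0)
    (PP PP0 PP1 : set (probability (subset_borel Z_neq0) R))
    (PP_dominated :
      exists mu : {sigma_finite_measure set (subset_borel Z_neq0) -> \bar R},
        forall P, PP P -> P `<< mu)
    (PP_partition : partition_in_two PP PP0 PP1) :
  (forall Q, PP1 Q ->
    exists Ps : nat -> probability (subset_borel Z_neq0) R,
      (forall k, co PP0 (Ps k)) /\ dTV (Ps k) Q @[k --> \oo] --> 0)
  <->
  (forall phi : subset_borel Z_neq0 -> R, is_test phi ->
    forall Q, PP1 Q -> 'E_Q[phi] <= ereal_sup [set 'E_P[phi] | P in PP0]).
Proof.
have [mu PPmu] := PP_dominated; have [PPE PP0_neq0 _ _] := PP_partition.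
have [nu mu_nu] := finite_measure_dominating mu.
have PPnu P : PP P -> P `<< nu.
  by move=> PPP; exact: null_dominates_trans (PPmu _ PPP) mu_nu.
have PP0nu P : PP0 P -> P `<< nu by move=> ?; apply: PPnu; rewrite PPE; left.
have PP1nu P : PP1 P -> P `<< nu by move=> ?; apply: PPnu; rewrite PPE; right.
split => [approx phi tphi Q PP1Q|test Q PP1Q].
  have [Ps [coPs Ps_cvg]] := approx Q PP1Q.
  set S := ereal_sup _.
  (* Finiteness of [S] is not established here: the limit of the sum makes sense because the second
     limit, 0, is finite. *)
  have S_cvg : S + dTV (Ps k) Q @[k --> \oo] --> S.
    rewrite -[X in _ --> X]adde0; apply: cvgeD => //; last exact: cvg_cst.
    by rewrite fin_num_adde_defl.
  apply: (cvge_to_ge S_cvg); apply: nearW => k.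
  apply: le_trans (expectation_le_dTV (co_dominates PP0nu (coPs k)) (PP1nu _ PP1Q) tphi) _.
  by apply: leeD => //; exact: expectation_co_le.
have near_Q (k : nat) : exists P, co PP0 P /\ dTV P Q < (k.+1%:R^-1)%:E.
  have [|P cP ltP] := co_dTV_approx PP0nu PP0_neq0 (PP1nu _ PP1Q) _
    (fun phi tphi => test phi tphi Q PP1Q) (eps := k.+1%:R^-1); last by exists P.
  by rewrite invr_gt0.
have [Ps /all_and2[coPs lt_Ps]] := choice near_Q.
exists Ps; split => //.
apply: (@squeeze_cvge _ _ _ _ (cst 0) _ (fun k => (k.+1%:R^-1)%:E)).
- apply: nearW => k; rewrite (ltW (lt_Ps k)) andbT.
  (* The distance is nonnegative as the supremum of a set of absolute values that is nonempty,
     [set0] being measurable. *)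
  apply: le_trans (ereal_sup_ubound _); last by exists set0.
  exact: abse_ge0.
- exact: cvg_cst.
- by apply: cvg_EFin; [exact: nearW|exact: cvg_harmonic].
Qed.
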